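(* Let ${\approx_\varepsilon}\in\{{\approx_\varepsilon^b},{\approx_\varepsilon^w}\}$. Then there are LMCs with states $s,t$ such that (i) $s\sim_\varepsilon t$ and $s\equiv_\varepsilon t$ but $s\not\approx_\varepsilon t$, and (ii) $s\approx_\varepsilon t$ but $s\not\sim_\varepsilon t$ and $s\not\equiv_\varepsilon t$. Hence, $\approx_\varepsilon$ and $\sim_\varepsilon,\equiv_\varepsilon$ are incomparable. Furthermore, (i) and (ii) also hold for $\sim_\varepsilon^*$ and $\equiv_\varepsilon^*$ instead of $\sim_\varepsilon$ and $\equiv_\varepsilon$.
   Context: Throughout, $\varepsilon\in[0,1]$ denotes a tolerance. Fix a countable set $AP$ of atomic propositions. A labeled Markov chain (LMC) $\mathcal{M}=(S,P,s_{init},l)$ has a countable nonempty state set $S$, a transition function $P\colon S\to Distr(S)$ ($Distr(S)$ is the set of probability distributions on $S$), an initial state $s_{init}\in S$ and a labeling $l\colon S\to 2^{AP}$. LMCs are assumed finitely branching: $\{t\mid P(s)(t)>0\}$ is finite for every $s$. $P(s)(A)=\sum_{t\in A}P(s)(t)$. $\mathrm{Pr}_s$ is the standard probability measure on infinite paths starting in $s$. For $B,C\subseteq S$, $\mathrm{Pr}_s(B\,\mathsf{U}\,C)$ is the probability that a path from $s$ eventually visits $C$ with all states before the first visit to $C$ lying in $B$ (so it is $1$ if $s\in C$). $L(s)=\{t\in S\mid l(t)=l(s)\}$. For $R\subseteq S\times S$ and $A\subseteq S$, $R(A)=\{t\mid\exists s\in A\colon(s,t)\in R\}$, and $A$ is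 $R$-closed if $R(A)\subseteq A$. All relations $R$ below are required to relate only states with equal labels. - A reflexive and symmetric $R$ is an $\varepsilon$-bisimulation if $P(s)(A)\le P(t)(R(A))+\varepsilon$ for all $(s,t)\in R$ and all $A\subseteq S$. $s\sim_\varepsilon t$ (resp. $s\sim_\varepsilon^* t$) if $(s,t)\in R$ for some $\varepsilon$-bisimulation (resp. transitive $\varepsilon$-bisimulation) $R$. - A reflexive and symmetric $R$ is an $\varepsilon$-APB if $|P(s)(A)-P(t)(A)|\le\varepsilon$ for all $(s,t)\in R$ and all $R$-closed $A\subseteq S$. $s\equiv_\varepsilon t$ (resp. $s\equiv_\varepsilon^* t$) if $(s,t)\in R$ for some $\varepsilon$-APB (resp. transitive $\varepsilon$-APB) $R$. - An equivalence $R$ with classes $[s]_R$ is a branching $\varepsilon$-bisimulation if $|\mathrm{Pr}_s([s]_R\,\mathsf{U}\,A)-\mathrm{Pr}_t([t]_R\,\mathsf{U}\,A)|\le\varepsilon$ for all $(s,t)\in R$ and all $R$-closed $A\subseteq S$. $s\approx_\varepsilon^b t$ if $(s,t)\in R$ for some such $R$. - A reflexive and symmetric $R$ is a weak $\varepsilon$-bisimulation if $\mathrm{Pr}_s(L(s)\,\mathsf{U}\,A)\le\mathrm{Pr}_t(L(t)\,\mathsf{U}\,R(A))+\varepsilon$ for all $(s,t)\in R$ and all $A\subseteq S$. $s\approx_\varepsilon^w t$ if $(s,t)\in R$ for some such $R$.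
   Formalization: The set AP is assumed nonempty and ε<1, and (i) and the incomparability are claimed only for ε>0: at ε=0 ∼ and ≡ imply ≈, so (i) fails; at ε=1 or for empty AP all the relations are equality of labels, so (i) and (ii) fail. *)

(* Defs.v *)
From Corelib Require Export RelationClasses.
From HB Require Import structures.
From mathcomp Require Export all_boot all_order all_algebra.
From mathcomp Require Export boolp classical_sets functions cardinality fsbigop.
From mathcomp Require Export reals ereal topology normedtype sequences.
From mathcomp Require Export measure lebesgue_measure probability.

Set Implicit Arguments.
Unset Strict Implicit.
Unset Printing Implicit Defensive.

Import Order.TTheory GRing.Theory Num.Theory.

Local Open Scope classical_set_scope.
Local Open Scope ring_scope.

(* Finite branching makes every sum over a set of successors a finite-support
   sum, so that the [\sum_(t \in A)] operator is the true (possibly countable)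
   sum. *)
Record lmc (R : realType) (AP : countType) := Lmc {
  state :> countType ;
  trans : state -> state -> R ;
  init : state ;
  label : state -> set AP ;
  trans_ge0 : forall s t, 0 <= trans s t ;
  finitely_branching : forall s, finite_set [set t | 0 < trans s t] ;
  trans_sum1 : forall s, \sum_(t \in [set: state]) trans s t = 1
}.

Definition trans_set (R : realType) (AP : countType) (M : lmc R AP)
    (s : M) (A : set M) : R :=
  \sum_(t \in A) trans s t.

Definition run (R : realType) (AP : countType) (M : lmc R AP) : Type :=
  nat -> M.

HB.instance Definition _ (R : realType) (AP : countType) (M : lmc R AP) :=
  Choice.on (run M).
HB.instance Definition _ (R : realType) (AP : countType) (M : lmc R AP) :=
  isPointed.Build (run M) (fun=> init M).

Definition cylinder (R : realType) (AP : countType) (M : lmc R AP)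
    (p : seq M) : set (run M) :=
  [set w | mkseq w (size p) = p].

Definition runs (R : realType) (AP : countType) (M : lmc R AP) :=
  g_sigma_algebraType (range (@cylinder R AP M)).

Fixpoint weight (R : realType) (AP : countType) (M : lmc R AP)
    (s : M) (p : seq M) : R :=
  if p is t :: q then trans s t * weight t q else 1.

Definition is_path_measure (R : realType) (AP : countType) (M : lmc R AP)
    (s : M) (mu : probability (runs M) R) : Prop :=
  forall p : seq M, mu (cylinder (s :: p)) = (weight s p)%:E.

(* Existence of the path measure: inverse transform sampling, which reads an
   infinite path off a uniformly distributed number in [0, 1[. *)
Section path_measure_existence.
Variables (R : realType) (AP : countType) (M : lmc R AP).
Implicit Types (s t : M) (p q : seq M) (u a : R) (n i : nat).

Let pn s i : R := oapp (trans s) 0 (@pickle_inv M i).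
Let cum s n : R := \sum_(i < n) pn s i.

Let pn_ge0 s i : 0 <= pn s i.
Proof. by rewrite /pn; case: (@pickle_inv M i) => //= t; exact: trans_ge0. Qed.

Let pnE s t : pn s (pickle t) = trans s t.
Proof. by rewrite /pn pickleK_inv. Qed.

Let cumS s n : cum s n.+1 = cum s n + pn s n.
Proof. by rewrite /cum big_ord_recr. Qed.

Let cum_le s m n : (m <= n)%N -> cum s m <= cum s n.
Proof.
move=> mn; rewrite -(subnKC mn); elim: (n - m)%N => [|k IH]; first by rewrite addn0.
by rewrite addnS cumS (le_trans IH)// lerDl.
Qed.

Let cum_eventually1 s : exists N, forall n, (N <= n)%N -> cum s n = 1.
Proof.
have fS := finitely_branching s.
have [N Nb] : exists N, forall t, 0 < trans s t -> (pickle t < N)%N.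
  have [r rE] := (finite_seqP _).1 fS.
  exists (\max_(t <- r) pickle t).+1 => t t0; rewrite ltnS.
  by apply: leq_bigmax_seq => //; have : [set` r] t by rewrite -rE.
exists N => n Nn; rewrite -(trans_sum1 s) /cum fsbig_ord.
have pn0 i : ~ (exists2 t, 0 < trans s t & pickle t = i) -> pn s i = 0.
  move=> h; rewrite /pn; case E: (@pickle_inv M i) => [t|]//=.
  apply/eqP; rewrite eq_le trans_ge0 andbT leNgt; apply/negP => t0.
  apply: h; exists t => //.
  by have := @pickle_invK M i; rewrite E.
transitivity (\sum_(i \in [set: nat]) pn s i).
  apply: fsbig_widen => // i [_ /= ni]; apply: pn0 => -[t t0 ti].
  by apply: ni; rewrite -ti /= (leq_trans (Nb _ t0)).
transitivity (\sum_(i \in pickle @` [set: M]) pn s i).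
  apply/esym/fsbig_widen => // i [_ /= ni]; apply: pn0 => -[t t0 ti].
  by apply: ni; exists t.
rewrite fsbig_image; last by move=> x y _ _; exact: (pcan_inj pickleK_inv).
by apply: eq_fsbigr => t _; rewrite pnE.
Qed.

Let cum_le1 s n : cum s n <= 1.
Proof.
have [N h] := cum_eventually1 s.
by rewrite -(h (maxn n N) (leq_maxr _ _)) cum_le// leq_maxl.
Qed.

Let slot s t : set R := [set u | cum s (pickle t) <= u < cum s (pickle t).+1].

Let nxt s u : M := xget (init M) [set t | slot s t u].

Let slot_ex s u : 0 <= u < 1 -> exists t, slot s t u.
Proof.
move=> /andP[u0 u1]; have [N h] := cum_eventually1 s.
have ex : exists n, u < cum s n by exists N; rewrite h.
case: (ex_minnP ex) => -[|n] un min.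
  by move: un; rewrite /cum big_ord0 ltNge u0.
have nu : cum s n <= u.
  by rewrite leNgt; apply/negP => /min; rewrite ltnn.
move: (le_lt_trans nu un); rewrite cumS ltrDl /pn.
case E: (@pickle_inv M n) => [t|] /=; rewrite ?ltxx// => _.
have tn : pickle t = n by have := @pickle_invK M n; rewrite E.
by exists t; rewrite /slot /= tn nu.
Qed.

Let slot_uniq s t t' u : slot s t u -> slot s t' u -> t = t'.
Proof.
move=> /andP[a1 a2] /andP[b1 b2]; apply: (pcan_inj (@pickleK_inv M)).
apply/eqP; rewrite eqn_leq; apply/andP; split; rewrite leqNgt; apply/negP => tt.
- by have := lt_le_trans b2 (le_trans (cum_le s tt) a1); rewrite ltxx.
- by have := lt_le_trans a2 (le_trans (cum_le s tt) b1); rewrite ltxx.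
Qed.

Let nxtP s t u : 0 <= u < 1 -> nxt s u = t <-> slot s t u.
Proof.
move=> u01; have [t' t'u] := slot_ex s u01.
have nu : slot s (nxt s u) u.
  by rewrite /nxt; case: xgetP => [y _|/(_ t')/(_ t'u)].
by split=> [<-//|tu]; exact: slot_uniq nu tu.
Qed.

Let step (x : M * R) : M * R :=
  (nxt x.1 x.2, (x.2 - cum x.1 (pickle (nxt x.1 x.2))) / trans x.1 (nxt x.1 x.2)).

Let sample s u : runs M := fun n => (iter n step (s, u)).1.

Let weight_ge0 s p : 0 <= weight s p.
Proof. by elim: p s => //= t q IH s; rewrite mulr_ge0// trans_ge0. Qed.

Let mkseqS (T : Type) (f : nat -> T) n :
  mkseq f n.+1 = f 0%N :: mkseq (fun i => f i.+1) n.
Proof. by rewrite /mkseq /= (iotaDl 1 0) -map_comp. Qed.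

Let sampleE s p : exists a, [/\ 0 <= a, a + weight s p <= 1 &
  `[0, 1[%classic `&` sample s @^-1` cylinder (s :: p) = `[a, a + weight s p[%classic].
Proof.
elim: p s => [|t q IH] s.
  exists 0; split=> //=; rewrite add0r ?lexx//.
  by apply/seteqP; split=> u /= => [[]//|u01]; split.
have mk u : mkseq (sample s u) (size (t :: q)).+1 = s :: mkseq
    (sample (nxt s u) (step (s, u)).2) (size q).+1.
  rewrite mkseqS; congr (_ :: _); apply: eq_mkseq => i.
  by rewrite /sample iterSr.
have [a [a0 a1 aE]] := IH t.
have := trans_ge0 s t; rewrite le_eqVlt => /orP[/eqP p0|p0].
  exists 0; rewrite /= -p0 mul0r addr0; split=> //.
  rewrite set_itvco0; apply/seteqP; split=> u //= [].
  rewrite in_itv/= => u01; rewrite /cylinder/= mk => -[] /(nxtP _ _ u01).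
  by rewrite /slot/= cumS pnE -p0 addr0 => /andP[/le_lt_trans h /h]; rewrite ltxx.
have w0 := weight_ge0 t q.
have c1 := cum_le1 s (pickle t).+1; rewrite cumS pnE in c1.
have c0 : 0 <= cum s (pickle t) by apply: sumr_ge0.
exists (cum s (pickle t) + trans s t * a); split => /=.
- by rewrite addr_ge0// mulr_ge0// ltW.
- rewrite -addrA -mulrDr (le_trans _ c1)// lerD2l.
  by rewrite ger_pMr.
have memE u : (cum s (pickle t) + trans s t * a <= u <
    cum s (pickle t) + trans s t * a + trans s t * weight t q) =
    (a <= (u - cum s (pickle t)) / trans s t < a + weight t q).
  rewrite ler_pdivlMr// ltr_pdivrMr// lerBrDl ltrBlDl.
  by rewrite -addrA -mulrDr ![trans s t * _]mulrC.
apply/seteqP; split=> u /=.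
  rewrite /cylinder/= mk !in_itv/= => -[u01 /(congr1 behead) qE].
  have tE : nxt s u = t := congr1 (head t) qE.
  have /(nxtP _ _ u01) := tE; rewrite /slot/= cumS pnE => /andP[b1 b2].
  rewrite memE.
  have : (`[0, 1[%classic `&` sample t @^-1` cylinder (t :: q))
      ((u - cum s (pickle t)) / trans s t).
    split; last by move: qE; rewrite /= tE.
    rewrite /= in_itv /= divr_ge0 ?subr_ge0 ?(ltW p0)//=.
    by rewrite ltr_pdivrMr// mul1r ltrBlDl.
  by rewrite aE /= in_itv.
rewrite !in_itv/= memE => h.
have [v01 vc] : (`[0, 1[%classic `&` sample t @^-1` cylinder (t :: q))
    ((u - cum s (pickle t)) / trans s t) by rewrite aE /= in_itv.
move: v01; rewrite /= in_itv/= => /andP[v0 v1].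
rewrite pmulr_lge0 ?invr_gt0// subr_ge0 in v0.
rewrite ltr_pdivrMr// mul1r ltrBlDl in v1.
have u01 : 0 <= u < 1 by rewrite (le_trans c0 v0)/= (lt_le_trans v1).
split=> //; rewrite /cylinder/= mk.
have tE : nxt s u = t by apply/nxtP => //; rewrite /slot/= cumS pnE v0.
by rewrite -[in RHS]vc /= tE.
Qed.

Let msample s : measurable_fun (`[0, 1[%classic : set R) (sample s).
Proof.
apply: (@measurability _ _ _ (runs M) _ _ (range (@cylinder R AP M))) => //.
move=> _ [_ [p _ <-] <-]; case: p => [|t p].
  suff -> : @cylinder R AP M [::] = setT by rewrite preimage_setT setIT.
  by apply/seteqP; split.
have [->|ts] := eqVneq t s.
  by have [a [_ _ ->]] := sampleE s p.
rewrite (_ : _ `&` _ = set0)//; apply/seteqP; split=> u //= [_].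
by rewrite /cylinder/= => -[/esym/eqP]; rewrite (negbTE ts).
Qed.

Section measure.
Variable s : M.

Definition sampled_measure (A : set (runs M)) : \bar R :=
  lebesgue_measure (`[0, 1[%classic `&` sample s @^-1` A).

Let mu0 : sampled_measure set0 = 0%E.
Proof. by rewrite /sampled_measure preimage_set0 setI0 measure0. Qed.

Let mu_ge0 A : (0 <= sampled_measure A)%E.
Proof. exact: measure_ge0. Qed.

Let mu_sigma_additive : semi_sigma_additive sampled_measure.
Proof.
move=> F mF tF mUF; rewrite /sampled_measure preimage_bigcup setI_bigcupr.
apply: measure_semi_sigma_additive.
- by move=> n; exact: msample.
- apply/trivIsetP => /= i j _ _ ij; apply/seteqP; split=> u //= [[_ Fi] [_ Fj]].
  have /trivIsetP/(_ i j Logic.I Logic.I ij) FF := tF.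
  by have : (F i `&` F j) (sample s u) by []; rewrite FF.
- by rewrite -setI_bigcupr -preimage_bigcup; exact: msample.
Qed.

HB.instance Definition _ :=
  isMeasure.Build _ _ _ sampled_measure mu0 mu_ge0 mu_sigma_additive.

Let mu_setT : sampled_measure setT = 1%E.
Proof.
by rewrite /sampled_measure preimage_setT setIT lebesgue_measure_itv/= lte_fin ltr01 oppr0 adde0.
Qed.

HB.instance Definition _ := Measure_isProbability.Build _ _ _ sampled_measure mu_setT.

Lemma path_measure_ex : exists mu : probability (runs M) R, is_path_measure s mu.
Proof.
exists (sampled_measure : probability _ _) => p.
have [a [a0 a1 aE]] := sampleE s p.
rewrite [LHS]/= /sampled_measure aE lebesgue_measure_itv/= lte_fin ltrDl.
have := weight_ge0 s p; rewrite le_eqVlt => /orP[/eqP <-|w0]; first by rewrite ltxx.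
by rewrite w0 -EFinD addrAC subrr add0r.
Qed.

End measure.
End path_measure_existence.

(* The choice is immaterial: the cylinders and the empty set form a
   pi-system generating the sigma-algebra of [runs M], so a path measure is
   unique. *)
Definition Pr (R : realType) (AP : countType) (M : lmc R AP) (s : M) :
  probability (runs M) R := sval (cid (path_measure_ex s)).

Lemma Pr_cylinder (R : realType) (AP : countType) (M : lmc R AP) (s : M)
  (p : seq M) : Pr s (cylinder (s :: p)) = (weight s p)%:E.
Proof. exact: (svalP (cid (path_measure_ex s))). Qed.

Definition until (R : realType) (AP : countType) (M : lmc R AP)
    (B C : set M) : set (runs M) :=
  [set w | exists n, C (w n) /\ forall i, (i < n)%N -> B (w i) /\ ~ C (w i)].

Definition Pruntil (R : realType) (AP : countType) (M : lmc R AP)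
    (s : M) (B C : set M) : R :=
  fine (Pr s (until B C)).

Definition same_label (R : realType) (AP : countType) (M : lmc R AP)
    (s : M) : set M :=
  [set t | label t = label s].

Definition rel_image (T : Type) (E : T -> T -> Prop) (A : set T) : set T :=
  [set t | exists2 s, A s & E s t].

Definition rel_closed (T : Type) (E : T -> T -> Prop) (A : set T) : Prop :=
  rel_image E A `<=` A.

Definition label_compatible (R : realType) (AP : countType) (M : lmc R AP)
    (E : M -> M -> Prop) : Prop :=
  forall s t, E s t -> label s = label t.

Definition eps_bisimulation (R : realType) (AP : countType) (eps : R)
    (M : lmc R AP) (E : M -> M -> Prop) : Prop :=
  [/\ Reflexive E, Symmetric E, label_compatible E &
    forall s t, E s t -> forall A : set M,
      trans_set s A <= trans_set t (rel_image E A) + eps].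

Definition eps_bisimilar (R : realType) (AP : countType) (eps : R)
    (M : lmc R AP) (s t : M) : Prop :=
  exists E : M -> M -> Prop, eps_bisimulation eps E /\ E s t.

Definition trans_eps_bisimilar (R : realType) (AP : countType) (eps : R)
    (M : lmc R AP) (s t : M) : Prop :=
  exists E : M -> M -> Prop, [/\ eps_bisimulation eps E, Transitive E & E s t].

Definition eps_apb (R : realType) (AP : countType) (eps : R)
    (M : lmc R AP) (E : M -> M -> Prop) : Prop :=
  [/\ Reflexive E, Symmetric E, label_compatible E &
    forall s t, E s t -> forall A : set M, rel_closed E A ->
      `|trans_set s A - trans_set t A| <= eps].

Definition apb_equiv (R : realType) (AP : countType) (eps : R)
    (M : lmc R AP) (s t : M) : Prop :=
  exists E : M -> M -> Prop, eps_apb eps E /\ E s t.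

Definition trans_apb_equiv (R : realType) (AP : countType) (eps : R)
    (M : lmc R AP) (s t : M) : Prop :=
  exists E : M -> M -> Prop, [/\ eps_apb eps E, Transitive E & E s t].

(* For an equivalence [E], the class of [s] is the set [E s]. *)
Definition branching_eps_bisimulation (R : realType) (AP : countType) (eps : R)
    (M : lmc R AP) (E : M -> M -> Prop) : Prop :=
  [/\ Equivalence E, label_compatible E &
    forall s t, E s t -> forall A : set M, rel_closed E A ->
      `|Pruntil s (E s) A - Pruntil t (E t) A| <= eps].

Definition branching_eps_bisimilar (R : realType) (AP : countType) (eps : R)
    (M : lmc R AP) (s t : M) : Prop :=
  exists E : M -> M -> Prop, branching_eps_bisimulation eps E /\ E s t.

Definition weak_eps_bisimulation (R : realType) (AP : countType) (eps : R)
    (M : lmc R AP) (E : M -> M -> Prop) : Prop :=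
  [/\ Reflexive E, Symmetric E, label_compatible E &
    forall s t, E s t -> forall A : set M,
      Pruntil s (same_label s) A
        <= Pruntil t (same_label t) (rel_image E A) + eps].

Definition weak_eps_bisimilar (R : realType) (AP : countType) (eps : R)
    (M : lmc R AP) (s t : M) : Prop :=
  exists E : M -> M -> Prop, weak_eps_bisimulation eps E /\ E s t.

Definition incomparable (R : realType) (AP : countType)
    (r1 r2 : forall M : lmc R AP, M -> M -> Prop) : Prop :=
  ~ (forall (M : lmc R AP) (s t : M), r1 M s t -> r2 M s t) /\
  ~ (forall (M : lmc R AP) (s t : M), r2 M s t -> r1 M s t).

(* Main.v *)
(* On the states 0, 1, 2, ... put one label on {0, 1} and another on U = {2, 3, ...}.
   (i) Let every state idle with probability 1 - eps, while with probability eps the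
   state 1 jumps to 2.  A move of probability eps is invisible to ~_eps and ==_eps, so
   0 and 1 are related; but 0 never reaches U, while 1 reaches U with probability at
   least eps + eps (1 - eps) > eps.
   (ii) Let n move to n + 1 with probability 1.  Then 0 and 1 both reach U surely
   through equally labelled states, so only the number of stuttering steps differs;
   but in a single step 1 enters U with probability 1 and 0 with probability 0. *)
Require Import Defs.
From mathcomp Require Import lra zify.

Import Order.TTheory GRing.Theory Num.Theory.
Local Open Scope classical_set_scope.
Local Open Scope ring_scope.

Lemma mkseq_cons (T : Type) (f : nat -> T) n :
  mkseq f n.+1 = f 0%N :: mkseq (f \o succn) n.
Proof. by rewrite /mkseq /= (iotaDl 1 0) -map_comp. Qed.

(** * Closed sets and the equal-label relation *)

Section closed_sets.
Context {R : realType} {AP : countType} {M : lmc R AP}.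
Implicit Types (E : M -> M -> Prop) (A B C : set M) (s t : M) (eps : R).

Lemma rel_image_closed {E A} : Reflexive E -> rel_closed E A -> rel_image E A = A.
Proof. by move=> rE cA; apply/seteqP; split=> // x Ax; exists x. Qed.

(** A closed set is its own image under a reflexive relation, so by symmetry the one-sided bound
    holds both ways. *)
Lemma eps_bisimulation_apb eps E : eps_bisimulation eps E -> eps_apb eps E.
Proof.
case=> rE sE lE bE; split=> // s t st A cA.
have := bE _ _ st A; have := bE _ _ (sE _ _ st) A.
by rewrite (rel_image_closed rE cA) ler_distl => ? ?; apply/andP; split; lra.
Qed.

(** The coarsest label-compatible relation. Its classes are definitionally the sets [same_label s],
    so branching and weak conditions use the same until events. *)
Definition label_equiv : M -> M -> Prop := fun s => same_label s.

Lemma label_equiv_equivalence : Equivalence label_equiv.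
Proof.
by split=> [s|s t|s t u]; rewrite /label_equiv /same_label //= => -> // ->.
Qed.

Lemma label_class_closed E (P : set (set AP)) :
  label_compatible E -> rel_closed E [set s | P (label s)].
Proof. by move=> lE t [s /= Ps st]; rewrite -(lE _ _ st). Qed.

Lemma weak_branching_label_equiv eps :
  weak_eps_bisimulation eps label_equiv -> branching_eps_bisimulation eps label_equiv.
Proof.
case=> rE sE _ wE; split=> //; first exact: label_equiv_equivalence.
move=> s t st A cA; have := wE _ _ st A; have := wE _ _ (sE _ _ st) A.
by rewrite (rel_image_closed rE cA) ler_distl => ? ?; apply/andP; split; lra.
Qed.

End closed_sets.

(** * Measurability of until events and paths of probability one *)

Section path_measure.
Context {R : realType} {AP : countType} {M : lmc R AP}.
Implicit Types (s t : M) (p : seq M) (B C : set M) (w : runs M).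

Lemma measurable_cylinder p : measurable (cylinder p : set (runs M)).
Proof. by apply: sub_sigma_algebra; exists p. Qed.

(** There are only countably many finite sequences, so an event decided by a prefix is a countable
    union of cylinders. *)
Lemma measurable_prefix n (Q : set (seq M)) :
  measurable ([set w | Q (mkseq w n)] : set (runs M)).
Proof.
rewrite (_ : [set w | _] = \bigcup_(p : seq M)
    (if `[< Q p /\ size p = n >] then cylinder p else set0)).
  apply: countable_bigcupT_measurable; first exact: countableP.
  by move=> p; case: ifP => // _; exact: measurable_cylinder.
apply/seteqP; split=> w /=.
  move=> Qw; exists (mkseq w n) => //; rewrite asboolT ?size_mkseq //.
  by rewrite /cylinder /= size_mkseq.
by case=> p _; case: asboolP => // -[Qp pn]; rewrite /cylinder /= pn => ->.
Qed.

Lemma measurable_until B C : measurable (until B C : set (runs M)).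
Proof.
pose Q n (p : seq M) := C (nth (init M) p n) /\ forall i, (i < n)%N ->
  B (nth (init M) p i) /\ ~ C (nth (init M) p i).
rewrite (_ : until B C = \bigcup_n [set w : runs M | Q n (mkseq w n.+1)]).
  apply: bigcupT_measurable => n; exact: (measurable_prefix n.+1 (Q n)).
apply/seteqP; split=> w /= [n].
  move=> [Cn Bi]; exists n => //; rewrite /Q /= nth_mkseq //; split=> // i ni.
  by rewrite nth_mkseq ?(ltn_trans ni) //; exact: Bi.
move=> _; rewrite /= /Q nth_mkseq // => -[Cn Bi]; exists n; split=> // i ni.
by have := Bi i ni; rewrite nth_mkseq // (ltn_trans ni).
Qed.

(** Any visit to [C] suffices: the least one supplies the avoidance of [C] beforehand. *)
Lemma untilI B C (w : nat -> M) n :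
  C (w n) -> (forall i, (i < n)%N -> B (w i)) -> until B C w.
Proof.
move=> Cn Bi; have ex : exists n, `[< C (w n) >] by exists n; exact/asboolP.
case: (ex_minnP ex) => m /asboolP Cm min; exists m; split=> // i im; split.
  apply: Bi; apply: leq_trans im _; apply: min; exact/asboolP.
by move=> /asboolP /min; rewrite leqNgt im.
Qed.

(** The path measure is the Dirac measure at [w], so every until probability is 0 or 1. *)
Lemma deterministic_Pruntil (w : nat -> M) B C :
  (forall n, trans (w n) (w n.+1) = 1) ->
  Pruntil (w 0%N) B C = `[< until B C w >]%:R.
Proof.
move=> w1.
have wt : forall n k, weight (w k) (mkseq (fun i => w (k + i.+1)%N) n) = 1.
  elim=> [|n IH] k; first by [].
  rewrite mkseq_cons /= addn1 w1 mul1r -[RHS](IH k.+1); congr weight.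
  by apply: eq_mkseq => i /=; rewrite addSnnS.
have null D : measurable (D : set (runs M)) -> ~ D w -> Pr (w 0%N) D = 0%E.
  move=> mD Dw; apply: measure_negligible => //.
  (* A run other than [w] leaves some prefix cylinder of [w]; these cylinders have measure 1, so
     their complements are countably many null sets. *)
  apply: (@negligibleS _ (runs M) R (Pr (w 0%N)) (\bigcup_n ~` cylinder (mkseq w n.+1))).
    move=> v Dv; apply: contrapT => nv; apply: Dw; suff <- : v = w by [].
    apply/funext => n; apply: contrapT => vn; apply: nv; exists n => // h; apply: vn.
    have : mkseq v (size (mkseq w n.+1)) = mkseq w n.+1 := h.
    rewrite size_mkseq => /(congr1 (fun p => nth (w 0%N) p n)).
    by rewrite !nth_mkseq.
  apply: negligible_bigcup => n; apply/negligibleP.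
    by apply: measurableC; exact: measurable_cylinder.
  have := probability_setC (Pr (w 0%N)) (measurable_cylinder (mkseq w n.+1)).
  suff -> : mkseq w n.+1 = w 0%N :: mkseq (fun i => w (0 + i.+1)%N) n.
    by rewrite Pr_cylinder wt subee.
  exact: mkseq_cons.
have mU := measurable_until B C; rewrite /Pruntil; case: asboolP => Uw; last first.
  by rewrite null.
have := probability_setC (Pr (w 0%N)) mU.
rewrite null; [|exact: measurableC|by move/(_ Uw)].
by move/esym/eqP; rewrite sube_eq ?fin_num_measure // add0e => /eqP <-.
Qed.

End path_measure.

(** * Chains with at most two successors per state *)

Section two_branch_chain.
Context {R : realType} {AP : countType} {T : countType}.
Variables (p : R) (p01 : 0 <= p <= 1) (f g : T -> T) (lab : T -> set AP) (x0 : T).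

Definition two_branch (x y : T) : R := p * (y == f x)%:R + (1 - p) * (y == g x)%:R.

Lemma fsbig_dirac (A : set T) (c : R) (a : T) :
  \sum_(y \in A) c * (y == a)%:R = c * (a \in A)%:R.
Proof.
have [Aa|nAa] := boolP (a \in A).
  rewrite -(fsbig_widen [set a]) ?fsbig_set1 ?eqxx //.
    by move=> _ /= ->; exact: set_mem.
  by move=> y [_ /= /eqP/negPf ->]; rewrite mulr0.
rewrite mulr0; apply: fsbig1 => y Ay; case: eqP => [ya|_]; last by rewrite mulr0.
by move: nAa; rewrite -ya mem_set.
Qed.

Lemma fsbig_two_branch (A : set T) x :
  \sum_(y \in A) two_branch x y = p * (f x \in A)%:R + (1 - p) * (g x \in A)%:R.
Proof.
have supp c a : \sum_(y \in A `&` [set f x; g x]) c * (y == a)%:R =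
    c * (a \in A `&` [set f x; g x])%:R := fsbig_dirac _ c a.
(* Splitting the sum needs a finite index set, hence the restriction to the possible successors. *)
rewrite -(fsbig_widen (A `&` [set f x; g x])); first last.
- move=> y [Ay nfg]; rewrite /= /two_branch.
  have [yf|_] := eqVneq y (f x); first by case: nfg; split=> //; left.
  have [yg|_] := eqVneq y (g x); first by case: nfg; split=> //; right.
  by rewrite !mulr0 addr0.
- by move=> y [].
rewrite fsbig_split; last by apply: finite_setIr; exact: finite_set2.
rewrite /= !fsbig_dirac !in_setI.
by rewrite !(@mem_set _ [set f x; g x]) ?andbT //=; [right|left].
Qed.

Lemma two_branch_ge0 x y : 0 <= two_branch x y.
Proof. by move: p01 => /andP[? ?]; rewrite addr_ge0 // mulr_ge0 // subr_ge0. Qed.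

Lemma two_branch_finitely_branching x : finite_set [set y | 0 < two_branch x y].
Proof.
apply: (@sub_finite_set _ _ [set f x; g x]); last exact: finite_set2.
move=> y /=; rewrite /two_branch.
have [-> _|_] := eqVneq y (f x); first by left.
have [-> _|_] := eqVneq y (g x); first by right.
by rewrite !mulr0 addr0 ltxx.
Qed.

Lemma two_branch_sum1 x : \sum_(y \in [set: T]) two_branch x y = 1.
Proof. by rewrite fsbig_two_branch !in_setT !mulr1 addrC subrK. Qed.

Definition chain : lmc R AP :=
  Lmc x0 lab two_branch_ge0 two_branch_finitely_branching two_branch_sum1.

End two_branch_chain.

(** * The two chains on the natural numbers *)

Section threshold_chain.
Context {R : realType} {AP : countType} (AP_nonempty : inhabited AP).
Variables (p : R) (p01 : 0 <= p <= 1).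
Implicit Types (f g : nat -> nat) (A : set nat).

Definition threshold_label (n : nat) : set AP := if (n < 2)%N then set0 else setT.

Definition threshold_chain f g : lmc R AP := chain p p01 f g threshold_label 0%N.

Lemma threshold_label_eq m n :
  threshold_label m = threshold_label n <-> (m < 2)%N = (n < 2)%N.
Proof.
have [a] := AP_nonempty; have nT : set0 <> setT :> set AP.
  by move=> /seteqP[_ /(_ a)]; apply.
by rewrite /threshold_label; case: ifP; case: ifP => _ _; split=> // /esym.
Qed.

Lemma threshold_trans_set f g (x : threshold_chain f g) (A : set (threshold_chain f g)) :
  trans_set x A = p * (f x \in (A : set nat))%:R + (1 - p) * (g x \in (A : set nat))%:R.
Proof. exact: fsbig_two_branch. Qed.

Definition upper f g : set (threshold_chain f g) := [set x | (2 <= x)%N].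

(** [upper] is the label class of 2. It is thus a legitimate test set against every candidate
    relation. *)
Lemma upper_closed f g (E : threshold_chain f g -> threshold_chain f g -> Prop) :
  label_compatible E -> rel_closed E (upper f g).
Proof.
move=> lE; have := label_class_closed _ [set threshold_label 2] lE.
suff -> : [set s : threshold_chain f g | [set threshold_label 2] (label s)] = upper f g by [].
apply/seteqP; split=> x /=; rewrite /upper /= leqNgt.
  by move=> /threshold_label_eq ->.
by move=> /negbTE x2; apply/threshold_label_eq; rewrite x2.
Qed.

(** The idling mass [1 - p] of [s] in [A] is matched by that of [t] in the image of [A]; the
    remaining mass is at most [p], whatever [f] is. *)
Lemma lazy_eps_bisimulation f :
  eps_bisimulation p (@label_equiv R AP (threshold_chain f id)).
Proof.
case: (@label_equiv_equivalence R AP (threshold_chain f id)) => rE sE _.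
split=> // s t st A; rewrite !threshold_trans_set.
have /andP[p0 p1] := p01.
have AE : ((s : nat) \in A) ==> ((t : nat) \in rel_image label_equiv A).
  by apply/implyP => /set_mem As; apply/mem_set; exists s.
move: AE; do 4 case: (_ \in _); rewrite //= ?mulr1 ?mulr0; lra.
Qed.

Definition escape (n : nat) : nat := if n == 1%N then 2%N else n.

Lemma lazy_escape_Pruntil0 (B : set (threshold_chain escape id)) :
  Pruntil (0%N : threshold_chain escape id) B (upper escape id) = 0.
Proof.
rewrite (@deterministic_Pruntil _ _ _ (fun=> 0%N : threshold_chain escape id)).
  by case: asboolP => // -[n []].
by move=> _; rewrite /= /two_branch /= !mulr1 addrC subrK.
Qed.

(** The disjoint cylinders that jump at the first or the second step already give this mass. *)
Lemma lazy_escape_Pruntil1 (B : set (threshold_chain escape id)) :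
  B 1%N -> p + p * (1 - p) <= Pruntil (1%N : threshold_chain escape id) B (upper escape id).
Proof.
move=> B1; pose M := threshold_chain escape id; pose one : M := 1%N; pose two : M := 2%N.
pose C q : set (runs M) := cylinder q.
have mC q : measurable (C q) by exact: measurable_cylinder.
have mU : measurable (until B (upper escape id) : set (runs M)) by exact: measurable_until.
rewrite -lee_fin /Pruntil fineK ?fin_num_measure //.
have -> : (p + p * (1 - p))%:E = Pr one (C [:: one; two] `|` C [:: one; one; two]).
  transitivity (Pr one (C [:: one; two]) + Pr one (C [:: one; one; two]))%E.
    rewrite !Pr_cylinder -EFinD; congr EFin.
    by rewrite /= /two_branch /escape /= !mulr1 !mulr0 !add0r !addr0 mulrC.
  apply/esym/measureU => //; apply/seteqP; split=> w //= [[_ w1] [_ w1' _]].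
  by rewrite w1 in w1'.
apply: le_measure; rewrite ?inE //; first exact: measurableU.
move=> w [] /= [].
  move=> w0 w1; apply: (@untilI _ _ _ _ _ _ 1%N) => [|[|//] _]; last by rewrite w0.
  by rewrite /upper /= w1.
move=> w0 w1 w2; apply: (@untilI _ _ _ _ _ _ 2%N) => [|[|[|//]] _].
- by rewrite /upper /= w2.
- by rewrite w0.
- by rewrite w1.
Qed.

Lemma succ_weak_bisimulation (eps : R) : 0 <= eps ->
  weak_eps_bisimulation eps (@label_equiv R AP (threshold_chain succn succn)).
Proof.
move=> eps0; case: (@label_equiv_equivalence R AP (threshold_chain succn succn)) => rE sE _.
split=> // s t st A.
have orbit (x : threshold_chain succn succn) B C :
    Pruntil x B C = `[< until B C (fun n => (x + n)%N : threshold_chain succn succn) >]%:R.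
  rewrite -deterministic_Pruntil /= ?addn0 // => n.
  by rewrite /two_branch addnS !eqxx !mulr1 addrC subrK.
rewrite !orbit.
suff : until (same_label s) A (fun n => (s + n)%N : threshold_chain succn succn) ->
    until (same_label t) (rel_image label_equiv A)
      (fun n => (t + n)%N : threshold_chain succn succn).
  move=> st'; case: asboolP => [/st' ?|_]; first by rewrite asboolT // lerDl.
  by rewrite addr_ge0.
move=> [n [An Ln]]; move: (st) => /threshold_label_eq ts.
(* If the visit to [A] carries the label of [s], then [t] itself lies in the image at time 0. *)
have [sn|sn] := eqVneq ((s + n)%N < 2)%N (s < 2)%N.
  apply: (@untilI _ _ _ _ _ _ 0%N) => //; exists (s + n)%N => //=.
  by apply/threshold_label_eq; rewrite addn0 ts sn.
(* Otherwise [s] and [t] are below 2 and the visit is not: [t] first reaches 2 after [2 - t] steps,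
   and 2 is label-equivalent to the visited state. *)
apply: (@untilI _ _ _ _ _ _ (2 - t)%N) => [|i it].
  exists (s + n)%N => //=; apply/threshold_label_eq; lia.
by apply/threshold_label_eq; lia.
Qed.

End threshold_chain.

(** * Separating pairs of states *)

Section witnesses.
Context {R : realType} {AP : countType} (AP_nonempty : inhabited AP).
Variables (eps : R) (eps_ge0 : 0 <= eps) (eps_lt1 : eps < 1).

Definition is_approx (approx : forall M : lmc R AP, M -> M -> Prop) : Prop :=
  approx = branching_eps_bisimilar eps \/ approx = weak_eps_bisimilar eps.

Lemma trans_bisimilar_not_approx (approx : forall M : lmc R AP, M -> M -> Prop) :
  0 < eps -> is_approx approx ->
  exists (M : lmc R AP) (s t : M),
    [/\ trans_eps_bisimilar eps s t, trans_apb_equiv eps s t & ~ approx M s t].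
Proof.
move=> eps_gt0 approxE.
have p01 : 0 <= eps <= 1 by rewrite eps_ge0 ltW.
pose M := @threshold_chain R AP eps p01 escape id.
have [rE sE tE] := @label_equiv_equivalence R AP M.
have bE : eps_bisimulation eps (@label_equiv R AP M) by exact: lazy_eps_bisimulation.
(* Leaving both staying sets arbitrary lets one inequality, violated by [eps * (1 - eps) > 0],
   refute the branching and the weak condition. *)
have gap (B B' : set M) : B' 1%N ->
    ~ Pruntil (1%N : M) B' (upper eps p01 escape id)
        <= Pruntil (0%N : M) B (upper eps p01 escape id) + eps.
  move=> /(lazy_escape_Pruntil1 _ p01); rewrite lazy_escape_Pruntil0 => h.
  move=> /(le_trans h); rewrite add0r gerDl leNgt mulr_gt0 // subr_gt0.
  exact/negP.
exists M, 0%N, 1%N; split.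
- by exists label_equiv.
- by exists label_equiv; split=> //; exact: eps_bisimulation_apb.
case: approxE => -> [E [[]]].
  case=> rE' _ _ lE wE /wE /(_ (upper eps p01 escape id) (upper_closed AP_nonempty _ _ _ _ _ lE)).
  by rewrite ler_distlC => /andP[_]; apply: gap.
move=> rE' sE' lE wE /sE' /wE /(_ (upper eps p01 escape id)).
rewrite (rel_image_closed rE' (upper_closed AP_nonempty _ _ _ _ _ lE)).
exact: gap.
Qed.

Lemma approx_not_apb_equiv (approx : forall M : lmc R AP, M -> M -> Prop) :
  is_approx approx ->
  exists (M : lmc R AP) (s t : M), approx M s t /\ ~ apb_equiv eps s t.
Proof.
(* Both branches are [succn], so any branching probability gives the same chain; 1 is chosen. *)
move=> approxE; have p01 : 0 <= (1 : R) <= 1 by rewrite ler01 lexx.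
pose M := @threshold_chain R AP 1 p01 succn succn.
have wE : weak_eps_bisimulation eps (@label_equiv R AP M) by exact: succ_weak_bisimulation.
exists M, 0%N, 1%N; split.
  case: approxE => ->; exists label_equiv; split=> //.
  exact: weak_branching_label_equiv.
move=> [E [[rE sE lE aE]]] /aE /(_ _ (upper_closed AP_nonempty _ _ _ _ _ lE)).
rewrite !threshold_trans_set memNset // mem_set // subrr mul0r mulr0.
by rewrite mul0r mulr1 !addr0 sub0r normrN1 leNgt eps_lt1.
Qed.

End witnesses.

(* The extreme tolerances are excluded exactly where the claim fails: at 0, eps-bisimilar
   states are bisimilar, hence also branching and weakly bisimilar; at 1, all six relations
   are equality of labels. *)
Theorem proposition5p5 (R : realType) (AP : countType) (AP_nonempty : inhabited AP)
    (eps : R) (eps_ge0 : 0 <= eps) (eps_lt1 : eps < 1)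
    (approx : forall M : lmc R AP, M -> M -> Prop)
    (approxE : approx = branching_eps_bisimilar eps
            \/ approx = weak_eps_bisimilar eps) :
  (0 < eps ->
    (exists (M : lmc R AP) (s t : M),
      [/\ eps_bisimilar eps s t, apb_equiv eps s t & ~ approx M s t]) /\
    (exists (M : lmc R AP) (s t : M),
      [/\ trans_eps_bisimilar eps s t, trans_apb_equiv eps s t
        & ~ approx M s t])) /\
  ((exists (M : lmc R AP) (s t : M),
      [/\ approx M s t, ~ eps_bisimilar eps s t & ~ apb_equiv eps s t]) /\
   (exists (M : lmc R AP) (s t : M),
      [/\ approx M s t, ~ trans_eps_bisimilar eps s t
        & ~ trans_apb_equiv eps s t])) /\
  (0 < eps ->
    incomparable approx (@eps_bisimilar R AP eps) /\
    incomparable approx (@apb_equiv R AP eps)).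
Proof.
have i := trans_bisimilar_not_approx AP_nonempty _ eps_ge0 eps_lt1.
have [M2 [s2 [t2 [a2 nE2]]]] :=
  approx_not_apb_equiv AP_nonempty _ eps_ge0 eps_lt1 _ approxE.
have nB2 : ~ eps_bisimilar eps s2 t2.
  by move=> [E [/eps_bisimulation_apb bE st]]; apply: nE2; exists E.
(* The transitive variants are finer: positive claims transfer from them to the plain relations,
   negative claims the other way. *)
have bW (M : lmc R AP) (s t : M) : trans_eps_bisimilar eps s t -> eps_bisimilar eps s t.
  by move=> [E [bE _ st]]; exists E.
have eW (M : lmc R AP) (s t : M) : trans_apb_equiv eps s t -> apb_equiv eps s t.
  by move=> [E [bE _ st]]; exists E.
split; last split.
- move=> eps_gt0; have [M [s [t [b e na]]]] := i _ eps_gt0 approxE.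
  by split; exists M, s, t; split=> //; [exact: bW|exact: eW].
- by split; exists M2, s2, t2; split=> // [/bW|/eW].
move=> eps_gt0; have [M [s [t [/bW b /eW e na]]]] := i _ eps_gt0 approxE.
by split; split=> h; [exact/nB2/h|exact/na/h|exact/nE2/h|exact/na/h].
Qed.
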